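(* Let $e\in\mathbb{N}$ and let $\Sigma$ be the set of $\mathscr{L}(K)$-formulas consisting of the axioms of a knowing machine together with all instances of Knowledge of Factivity, $K(K(\phi)\rightarrow\phi)$, and all instances of Knowledge of having Gödel number $e$, $K(K(\phi)\leftrightarrow\ulcorner\phi\urcorner\in W_e)$. Then $\Sigma$ is inconsistent.
   Context: Language. Let $\mathscr{L}$ be the first-order language of Peano Arithmetic ($PA$). The first-order language $\mathscr{L}(K)$ is defined inductively: it contains all function, constant and predicate symbols of $\mathscr{L}$, and for every formula $\phi$ of $\mathscr{L}(K)$ it contains a new $0$-ary predicate symbol $K_\phi$. Write $K(\phi)$ for $K_\phi$ (so $K(K(\phi))$ is $K_{K_\phi}$, etc.). Thus $K(\phi)$ is an atomic sentence, even if $\phi$ has free variables, and substitution for variables does not act inside $K(\cdot)$. Logic is ordinary classical first-order logic (with equality); implications associate to the right. Semantics. For a structure $\mathscr{M}$ and a formula $\phi$, $\mathscr{M}\models\phi$ means $\phi$ holds in $\mathscr{M}$ under all variable assignments; for a set $\Gamma$ of formulas, $\Gamma\models\phi$ means every model of $\Gamma$ satisfies $\phi$. The axioms of a knowing machine are the following schemas ($\phi,\psi$ ranging over $\mathscr{L}(K)$-formulas): (1) Knowledge of Tautology: $K(\phi)$ whenever $\phi$ is tautological (i.e. logically valid). (2) Knowledge Modus Ponens: $K(\phi\rightarrow\psi)\rightarrow K(\phi)\rightarrow K(\psi)$. (3) Knowledge of Arithmetic: $K(\phi)$ whenever $\phi$ is an axiom of $PA$. (4) Closure: $K(\phi)$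 whenever $\phi$ is an instance of (1), (2) or (3). (5) Factivity: $K(\phi)\rightarrow\phi$. Coding. Fix a standard Gödel numbering $\phi\mapsto\ulcorner\phi\urcorner\in\mathbb{N}$ of $\mathscr{L}(K)$-formulas, and let $W_e$ be the $e$-th r.e. subset of $\mathbb{N}$ in a standard enumeration. Inside formulas, ''$\ulcorner\phi\urcorner\in W_e$'' abbreviates a canonical sentence of the language of $PA$ expressing that $\ulcorner\phi\urcorner$ belongs to the $e$-th r.e. set. *)

(* Defs.v *)
From mathcomp Require Import all_boot zify.
Set Implicit Arguments.
Unset Strict Implicit.
Unset Printing Implicit Defensive.

Inductive term : Type :=
| Var (x : nat)
| Zero
| Succ (t : term)
| Add (s t : term)
| Mul (s t : term).

(* [K phi] is a 0-ary predicate symbol, so the variables of [phi] are neither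
   free nor bound in it and substitution does not enter it. *)
Inductive form : Type :=
| Equ (s t : term)
| Bot
| Imp (phi psi : form)
| And (phi psi : form)
| Or (phi psi : form)
| All (x : nat) (phi : form)
| Ex (x : nat) (phi : form)
| K (phi : form).

Definition Neg (phi : form) : form := Imp phi Bot.
Definition Iff (phi psi : form) : form := And (Imp phi psi) (Imp psi phi).

Fixpoint tsubst (x : nat) (r t : term) : term :=
  match t with
  | Var y => if y == x then r else Var y
  | Zero => Zero
  | Succ t => Succ (tsubst x r t)
  | Add s t => Add (tsubst x r s) (tsubst x r t)
  | Mul s t => Mul (tsubst x r s) (tsubst x r t)
  end.

(* Only used for terms [r] with no variable other than [x], for which no
   capture can occur. *)
Fixpoint subst (x : nat) (r : term) (phi : form) : form :=
  match phi with
  | Equ s t => Equ (tsubst x r s) (tsubst x r t)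
  | Bot => Bot
  | Imp phi psi => Imp (subst x r phi) (subst x r psi)
  | And phi psi => And (subst x r phi) (subst x r psi)
  | Or phi psi => Or (subst x r phi) (subst x r psi)
  | All y phi => if y == x then All y phi else All y (subst x r phi)
  | Ex y phi => if y == x then Ex y phi else Ex y (subst x r phi)
  | K phi => K phi
  end.

Fixpoint tvars (t : term) : seq nat :=
  match t with
  | Var y => [:: y]
  | Zero => [::]
  | Succ t => tvars t
  | Add s t | Mul s t => tvars s ++ tvars t
  end.

Fixpoint fvars (phi : form) : seq nat :=
  match phi with
  | Equ s t => tvars s ++ tvars t
  | Bot | K _ => [::]
  | Imp phi psi | And phi psi | Or phi psi => fvars phi ++ fvars psi
  | All x phi | Ex x phi => [seq y <- fvars phi | y != x]
  end.

Definition univ_closure (phi : form) : form := foldr All phi (undup (fvars phi)).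

(* Membership in the language of PA. *)
Fixpoint arithmetical (phi : form) : bool :=
  match phi with
  | Equ _ _ | Bot => true
  | Imp phi psi | And phi psi | Or phi psi => arithmetical phi && arithmetical psi
  | All _ phi | Ex _ phi => arithmetical phi
  | K _ => false
  end.

Record structure : Type := Structure {
  dom :> Type;
  zeroI : dom;
  succI : dom -> dom;
  addI : dom -> dom -> dom;
  mulI : dom -> dom -> dom;
  knowI : form -> Prop
}.

Section Semantics.
Variable M : structure.

Definition upd (s : nat -> M) (x : nat) (d : M) : nat -> M :=
  fun y => if y == x then d else s y.

Fixpoint eval (s : nat -> M) (t : term) : M :=
  match t with
  | Var x => s x
  | Zero => zeroI M
  | Succ t => succI (eval s t)
  | Add t u => addI (eval s t) (eval s u)
  | Mul t u => mulI (eval s t) (eval s u)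
  end.

Fixpoint sat (s : nat -> M) (phi : form) : Prop :=
  match phi with
  | Equ t u => eval s t = eval s u
  | Bot => False
  | Imp phi psi => sat s phi -> sat s psi
  | And phi psi => sat s phi /\ sat s psi
  | Or phi psi => sat s phi \/ sat s psi
  | All x phi => forall d : M, sat (upd s x d) phi
  | Ex x phi => exists d : M, sat (upd s x d) phi
  | K phi => knowI M phi
  end.

Definition models (phi : form) : Prop := forall s : nat -> M, sat s phi.

End Semantics.

Definition valid (phi : form) : Prop := forall M : structure, models M phi.

Definition entails (Gamma : form -> Prop) (phi : form) : Prop :=
  forall M : structure,
    (forall gamma, Gamma gamma -> models M gamma) -> models M phi.

Definition inconsistent (Gamma : form -> Prop) : Prop := entails Gamma Bot.

(* The axioms are sentences: induction is taken with parameters, universally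
   closed, for formulas of the language of PA. *)
Inductive PA : form -> Prop :=
| PA_succ_neq0 : PA (All 0 (Neg (Equ (Succ (Var 0)) Zero)))
| PA_succ_inj : PA (All 0 (All 1
    (Imp (Equ (Succ (Var 0)) (Succ (Var 1))) (Equ (Var 0) (Var 1)))))
| PA_add0 : PA (All 0 (Equ (Add (Var 0) Zero) (Var 0)))
| PA_addS : PA (All 0 (All 1
    (Equ (Add (Var 0) (Succ (Var 1))) (Succ (Add (Var 0) (Var 1))))))
| PA_mul0 : PA (All 0 (Equ (Mul (Var 0) Zero) Zero))
| PA_mulS : PA (All 0 (All 1
    (Equ (Mul (Var 0) (Succ (Var 1))) (Add (Mul (Var 0) (Var 1)) (Var 0)))))
| PA_induction phi x : arithmetical phi ->
    PA (univ_closure (Imp (subst x Zero phi)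
                (Imp (All x (Imp phi (subst x (Succ (Var x)) phi)))
                     (All x phi)))).

(* Instances of the first three schemas, the ones that Closure applies to. *)
Inductive basic_axiom : form -> Prop :=
| know_tautology phi : valid phi -> basic_axiom (K phi)
| know_mp phi psi : basic_axiom (Imp (K (Imp phi psi)) (Imp (K phi) (K psi)))
| know_arithmetic phi : PA phi -> basic_axiom (K phi).

Inductive knowing_machine : form -> Prop :=
| km_basic phi : basic_axiom phi -> knowing_machine phi
| km_closure phi : basic_axiom phi -> knowing_machine (K phi)
| km_factivity phi : knowing_machine (Imp (K phi) phi).

(* An injective pairing function which, having no division in it, is the value
   of a term of the language of PA. *)
Definition npair (x y : nat) : nat := (x + y) * (x + y) + y.

Lemma npair_inj x y x' y' : npair x y = npair x' y' -> x = x' /\ y = y'.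
Proof.
rewrite /npair => e.
have [lt|lt|eqs] := ltngtP (x + y) (x' + y'); [nia | nia |].
by rewrite eqs in e; lia.
Qed.

Fixpoint tcode (t : term) : nat :=
  match t with
  | Var x => npair 0 x
  | Zero => npair 1 0
  | Succ t => npair 2 (tcode t)
  | Add s t => npair 3 (npair (tcode s) (tcode t))
  | Mul s t => npair 4 (npair (tcode s) (tcode t))
  end.

Fixpoint code (phi : form) : nat :=
  match phi with
  | Equ s t => npair 0 (npair (tcode s) (tcode t))
  | Bot => npair 1 0
  | Imp phi psi => npair 2 (npair (code phi) (code psi))
  | And phi psi => npair 3 (npair (code phi) (code psi))
  | Or phi psi => npair 4 (npair (code phi) (code psi))
  | All x phi => npair 5 (npair x (code phi))
  | Ex x phi => npair 6 (npair x (code phi))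
  | K phi => npair 7 (code phi)
  end.

Lemma tcode_inj : injective tcode.
Proof.
elim=> [x||t IH|s IHs t IHt|s IHs t IHt] [x'||t'|s' t'|s' t'] /= /npair_inj[] //.
- by move=> _ ->.
- by move=> _ /IH ->.
- by move=> _ /npair_inj[/IHs -> /IHt ->].
- by move=> _ /npair_inj[/IHs -> /IHt ->].
Qed.

Lemma code_inj : injective code.
Proof.
elim=> [s t||a IHa b IHb|a IHa b IHb|a IHa b IHb|x a IHa|x a IHa|a IHa]
       [s' t'||a' b'|a' b'|a' b'|x' a'|x' a'|a'] /= /npair_inj[] //.
- by move=> _ /npair_inj[/tcode_inj -> /tcode_inj ->].
- by move=> _ /npair_inj[/IHa -> /IHb ->].
- by move=> _ /npair_inj[/IHa -> /IHb ->].
- by move=> _ /npair_inj[/IHa -> /IHb ->].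
- by move=> _ /npair_inj[-> /IHa ->].
- by move=> _ /npair_inj[-> /IHa ->].
- by move=> _ /IHa ->.
Qed.

(* [computes c x y]: the unary partial recursive function with index [c] is
   defined at [x], with value [y].  Functions of several arguments are
   represented through [npair]; a number which is not of one of the forms below
   is an index of the empty function. *)
Inductive computes : nat -> nat -> nat -> Prop :=
| comp_zero x : computes (npair 0 0) x 0
| comp_succ x : computes (npair 1 0) x x.+1
| comp_id x : computes (npair 2 0) x x
| comp_fst x y : computes (npair 3 0) (npair x y) x
| comp_snd x y : computes (npair 4 0) (npair x y) y
| comp_pair f g x y z : computes f x y -> computes g x z ->
    computes (npair 5 (npair f g)) x (npair y z)
| comp_comp f g x y z : computes g x y -> computes f y z ->
    computes (npair 6 (npair f g)) x z
| comp_rec0 f g x y : computes f x y ->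
    computes (npair 7 (npair f g)) (npair x 0) y
| comp_recS f g x m z y : computes (npair 7 (npair f g)) (npair x m) z ->
    computes g (npair x (npair m z)) y ->
    computes (npair 7 (npair f g)) (npair x m.+1) y
| comp_mu f x y (v : nat -> nat) : computes f (npair x y) 0 ->
    (forall j, j < y -> computes f (npair x j) (v j).+1) ->
    computes (npair 8 f) x y.

Definition W (e n : nat) : Prop := exists y, computes e n y.

Fixpoint numeral (n : nat) : term :=
  if n is m.+1 then Succ (numeral m) else Zero.

Definition tpair (s t : term) : term := Add (Mul (Add s t) (Add s t)) t.

(* The formulas below bind only the variables 0, ..., 15; the terms they are
   applied to avoid the variables bound inside. *)
Definition Less (s t : term) : form := Ex 0 (Equ (Add s (Succ (Var 0))) t).

(* Goedel's beta function: [r] is the remainder of [a] modulo [1 + (i + 1) b]. *)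
Definition Beta (a b i r : term) : form :=
  let m := Succ (Mul (Succ i) b) in
  Ex 1 (And (Equ a (Add (Mul (Var 1) m) r)) (Less r m)).

(* Variables 3 and 4 hold the code of a sequence of triples <c, <x, y>>, each of
   which follows from earlier ones by a clause of [computes]. *)
Definition Earlier (i c x y : term) : form :=
  Ex 2 (And (Less (Var 2) i) (Beta (Var 3) (Var 4) (Var 2) (tpair c (tpair x y)))).

Definition Justified (i c x y : term) : form :=
  let index1 k := tpair (numeral k) in
  let index2 k s t := index1 k (tpair s t) in
  let f := Var 9 in let g := Var 10 in
  let u := Var 11 in let v := Var 12 in let m := Var 13 in let j := Var 14 in
  Or (And (Equ c (index1 0 Zero)) (Equ y Zero))
  (Or (And (Equ c (index1 1 Zero)) (Equ y (Succ x)))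
  (Or (And (Equ c (index1 2 Zero)) (Equ y x))
  (Or (And (Equ c (index1 3 Zero)) (Ex 11 (Equ x (tpair y u))))
  (Or (And (Equ c (index1 4 Zero)) (Ex 11 (Equ x (tpair u y))))
  (Or (Ex 9 (Ex 10 (And (Equ c (index2 5 f g))
        (Ex 11 (Ex 12 (And (Equ y (tpair u v))
          (And (Earlier i f x u) (Earlier i g x v))))))))
  (Or (Ex 9 (Ex 10 (And (Equ c (index2 6 f g))
        (Ex 11 (And (Earlier i g x u) (Earlier i f u y))))))
  (Or (Ex 9 (Ex 10 (And (Equ c (index2 7 f g))
        (Ex 11 (And (Equ x (tpair u Zero)) (Earlier i f u y))))))
  (Or (Ex 9 (Ex 10 (And (Equ c (index2 7 f g))
        (Ex 11 (Ex 12 (Ex 13 (And (Equ x (tpair u (Succ m)))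
          (And (Earlier i c (tpair u m) v)
               (Earlier i g (tpair u (tpair m v)) y)))))))))
      (Ex 9 (And (Equ c (index1 8 f))
        (And (Earlier i f (tpair x y) Zero)
             (All 14 (Imp (Less j y)
               (Ex 12 (Earlier i f (tpair x j) (Succ v)))))))))))))))).

(* "n is in W_e", for terms [e] and [n] without the variables 0, ..., 15. *)
Definition MemW (e n : term) : form :=
  let a := Var 3 in let b := Var 4 in let i := Var 5 in
  let c := Var 6 in let x := Var 7 in let y := Var 8 in let l := Var 15 in
  Ex 3 (Ex 4 (Ex 15 (And
    (Ex 8 (Beta a b l (tpair e (tpair n y))))
    (All 5 (Imp (Less i (Succ l))
      (Ex 6 (Ex 7 (Ex 8 (And (Beta a b i (tpair c (tpair x y)))
                             (Justified i c x y)))))))))).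

Definition in_W (n e : nat) : form := MemW (numeral e) (numeral n).

Definition Sigma (e : nat) (phi : form) : Prop :=
  [\/ knowing_machine phi,
      exists psi, phi = K (Imp (K psi) psi) |
      exists psi, phi = K (Iff (K psi) (in_W (code psi) e))].

(* The standard model, for an arbitrary interpretation of the symbols [K phi]. *)
Definition standard (P : form -> Prop) : structure :=
  @Structure nat 0 S addn muln P.

Section MemW_correct.

Lemma beta_exists (f : nat -> nat) n :
  exists a b, forall i, i < n -> f i = a %% (i.+1 * b).+1.
Proof.
pose N := n + \sum_(i < n) f i; pose b := N`!; pose m i := (i.+1 * b).+1.
have fN i : i < n -> f i < m i.
  move=> ltin; have le1 : f i <= N.
    rewrite /N (bigD1 (Ordinal ltin)) //=; lia.
  have : N <= b by rewrite /b; case: (N) => // k; rewrite factS leq_pmulr ?fact_gt0.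
  rewrite /m; nia.
have com i j : i < j -> j < n -> coprime (m i) (m j).
  move=> ltij ltjn.
  have cb k : coprime (m k) b by rewrite coprime_sym /m -addn1 /coprime gcdnMDl gcdn1.
  rewrite /coprime -dvdn1; set d := gcdn _ _.
  have di : d %| m i by apply: dvdn_gcdl.
  have dj : d %| m j by apply: dvdn_gcdr.
  have cdb : coprime d b by apply: coprime_dvdl di (cb i).
  have : d %| (j - i) * b.
    have -> : (j - i) * b = m j - m i by rewrite /m; nia.
    exact: dvdn_sub.
  rewrite Gauss_dvdl // => dji.
  have dvb : d %| b.
    apply: dvdn_trans dji _; apply: dvdn_fact; rewrite /N; lia.
  by rewrite -(eqP cdb) dvdn_gcd dvdnn.
suff [a Ha] : exists a, forall i, i < n -> a = f i %[mod m i].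
  exists a, b => i ltin; rewrite -/(m i) Ha // modn_small ?fN //.
suff H k : k <= n -> exists a, forall i, i < k -> a = f i %[mod m i] by exact: H.
elim: k => [|k IH] ltkn; first by exists 0.
have [a Ha] := IH (ltnW ltkn).
have co : coprime (\prod_(i < k) m i) (m k).
  by elim/big_rec: _ => [|i x _ cx]; rewrite ?coprime1n // coprimeMl com.
exists (chinese (\prod_(i < k) m i) (m k) a (f k)) => i; rewrite ltnS leq_eqVlt.
case/orP=> [/eqP->|ltik]; first by rewrite chinese_modr.
have dv : m i %| \prod_(i < k) m i by rewrite (bigD1 (Ordinal ltik)) //= dvdn_mulr.
rewrite -Ha // -(modn_dvdm _ dv) chinese_modl // modn_dvdm //.
Qed.

Variable P : form -> Prop.
Let N := standard P.

Lemma eval_upd (s : nat -> N) x d t :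
  x \notin tvars t -> eval (upd s x d) t = eval s t.
Proof.
elim: t => [y||t IH|t IHt u IHu|t IHt u IHu] //=.
- by rewrite inE /upd eq_sym => /negbTE->.
- by move=> /IH->.
- by rewrite mem_cat negb_or => /andP[/IHt-> /IHu->].
- by rewrite mem_cat negb_or => /andP[/IHt-> /IHu->].
Qed.

Lemma eval_numeral (s : nat -> N) n : eval s (numeral n) = n.
Proof. by elim: n => //= n ->. Qed.

Lemma tvars_numeral n : tvars (numeral n) = [::].
Proof. by elim: n. Qed.

Definition fresh (n : nat) (ts : seq term) := all (fun t => all (leq n) (tvars t)) ts.

Lemma eval_fresh (s : nat -> N) x d t n : all (leq n) (tvars t) -> x < n ->
  eval (upd s x d) t = eval s t.
Proof.
move=> /allP fr lt; apply: eval_upd; apply/negP => /fr; lia.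
Qed.

Lemma sat_Less (s : nat -> N) t u : fresh 1 [:: t; u] ->
  sat s (Less t u) <-> (eval s t < eval s u).
Proof.
move=> /and3P[ft fu _] /=; split=> [[d]|lt].
  by rewrite /= !(eval_fresh _ _ ft, eval_fresh _ _ fu) // => <-; rewrite /upd /=; lia.
exists (eval s u - (eval s t).+1 : nat).
by rewrite /= !(eval_fresh _ _ ft, eval_fresh _ _ fu) //= /upd /=; lia.
Qed.

Lemma sat_Beta (s : nat -> N) a b i r : fresh 2 [:: a; b; i; r] ->
  sat s (Beta a b i r) <-> eval s r = eval s a %% ((eval s i).+1 * eval s b).+1 :> nat.
Proof.
move=> /and5P[fa fb fi fr _].
have fl : fresh 1 [:: r; Succ (Mul (Succ i) b)].
  by rewrite /fresh /= all_cat !andbT; do !(apply/andP; split);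
    apply: sub_all (_ : all (leq 2) _) => // x; lia.
rewrite /Beta; split=> [[q [/= e /(sat_Less _ fl)]]|e].
  move: e; rewrite /= !(eval_fresh _ _ fa, eval_fresh _ _ fb,
    eval_fresh _ _ fi, eval_fresh _ _ fr) // => -> lt.
  by rewrite /upd /= modnMDl modn_small.
exists (eval s a %/ ((eval s i).+1 * eval s b).+1 : nat); split.
  rewrite /= !(eval_fresh _ _ fa, eval_fresh _ _ fb,
    eval_fresh _ _ fi, eval_fresh _ _ fr) // e.
  by rewrite {1}/upd /= -divn_eq.
apply/(sat_Less _ fl); rewrite /= !(eval_fresh _ _ fa, eval_fresh _ _ fb,
    eval_fresh _ _ fi, eval_fresh _ _ fr) // e.
exact: ltn_pmod.
Qed.

Definition triple (a b i c x y : nat) : Prop :=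
  npair c (npair x y) = a %% (i.+1 * b).+1.

Definition earlier a b i c x y := exists2 j, j < i & triple a b j c x y.

Lemma sat_Earlier (s : nat -> N) i c x y : fresh 5 [:: i; c; x; y] ->
  sat s (Earlier i c x y) <->
  earlier (s 3) (s 4) (eval s i) (eval s c) (eval s x) (eval s y).
Proof.
move=> /and5P[fi fc fx fy _].
have sub n t : n <= 5 -> all (leq 5) (tvars t) -> all (leq n) (tvars t).
  by move=> le; apply: sub_all => z; lia.
have fl : fresh 1 [:: Var 2; i] by rewrite /fresh /= (sub 1).
have fb : fresh 2 [:: Var 3; Var 4; Var 2; tpair c (tpair x y)].
  by rewrite /fresh /= !all_cat (sub 2 c) // (sub 2 x) // (sub 2 y).
have E t d : all (leq 5) (tvars t) -> eval (upd s 2 d) t = eval s t.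
  by move=> f; rewrite (eval_fresh _ _ f).
rewrite /Earlier; split=> [[j [/(sat_Less _ fl) lt /(sat_Beta _ fb)]]|[j lt e]].
  rewrite /= (E c) // (E x) // (E y) // => e; exists j; last exact: e.
  by rewrite /= (E i) // in lt.
exists j; split; first by apply/(sat_Less _ fl); rewrite /= (E i).
by apply/(sat_Beta _ fb); rewrite /= (E c) // (E x) // (E y).
Qed.

Definition just (R : nat -> nat -> nat -> Prop) (c x y : nat) : Prop :=
  (c = npair 0 0 /\ y = 0) \/
  ((c = npair 1 0 /\ y = x.+1) \/
  ((c = npair 2 0 /\ y = x) \/
  ((c = npair 3 0 /\ exists u, x = npair y u) \/
  ((c = npair 4 0 /\ exists u, x = npair u y) \/
  ((exists f g, c = npair 5 (npair f g) /\
     exists u v, y = npair u v /\ R f x u /\ R g x v) \/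
  ((exists f g, c = npair 6 (npair f g) /\ exists u, R g x u /\ R f u y) \/
  ((exists f g, c = npair 7 (npair f g) /\
     exists u, x = npair u 0 /\ R f u y) \/
  ((exists f g, c = npair 7 (npair f g) /\
     exists u v m, x = npair u m.+1 /\
       R c (npair u m) v /\ R g (npair u (npair m v)) y) \/
  (exists f, c = npair 8 f /\ R f (npair x y) 0 /\
     forall j, j < y -> exists v, R f (npair x j) v.+1))))))))).

Lemma sat_Justified (s : nat -> N) :
  sat s (Justified (Var 5) (Var 6) (Var 7) (Var 8)) <->
  just (earlier (s 3) (s 4) (s 5)) (s 6) (s 7) (s 8).
Proof.
rewrite /Justified /just; cbn [sat].
setoid_rewrite sat_Earlier; try by [].
setoid_rewrite sat_Less; try by [].
Qed.

Lemma just_mono (R R' : nat -> nat -> nat -> Prop) c x y :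
  (forall c x y, R c x y -> R' c x y) -> just R c x y -> just R' c x y.
Proof.
move=> sub; rewrite /just.
do 5 (case=> [H|H]; [by left | right; move: H]).
case=> [[f [g [-> [u [v [-> [/sub Hf /sub Hg]]]]]]]|].
  by left; exists f, g; split=> //; exists u, v.
case=> [[f [g [-> [u [/sub Hg /sub Hf]]]]]|].
  by right; left; exists f, g; split=> //; exists u.
case=> [[f [g [-> [u [-> /sub Hf]]]]]|].
  by do 2 right; left; exists f, g; split=> //; exists u.
case=> [[f [g [-> [u [v [m [-> [/sub Hc /sub Hg]]]]]]]]|].
  by do 3 right; left; exists f, g; split=> //; exists u, v, m.
case=> f [-> [/sub H0 Hj]]; do 4 right; exists f; split=> //; split=> // j /Hj[v].
by move/sub; exists v.
Qed.

Lemma just_computes c x y : just computes c x y -> computes c x y.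
Proof.
rewrite /just.
case=> [[-> ->]|]; first exact: comp_zero.
case=> [[-> ->]|]; first exact: comp_succ.
case=> [[-> ->]|]; first exact: comp_id.
case=> [[-> [u ->]]|]; first exact: comp_fst.
case=> [[-> [u ->]]|]; first exact: comp_snd.
case=> [[f [g [-> [u [v [-> [Hf Hg]]]]]]]|]; first exact: comp_pair.
case=> [[f [g [-> [u [Hg Hf]]]]]|]; first exact: comp_comp Hg Hf.
case=> [[f [g [-> [u [-> Hf]]]]]|]; first exact: comp_rec0.
case=> [[f [g [-> [u [v [m [-> [Hc Hg]]]]]]]]|]; first exact: comp_recS Hc Hg.
case=> f [-> [H0 Hj]].
suff [v Hv] : exists v : nat -> nat,
    forall j, j < y -> computes f (npair x j) (v j).+1 by exact: comp_mu Hv.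
elim: y {H0} Hj => [|y IH] Hj; first by exists id.
have [v Hv] := IH (fun j lt => Hj j (ltnW lt)).
have [w Hw] := Hj y (ltnSn y).
exists (fun j => if j == y then w else v j) => j; rewrite ltnS leq_eqVlt.
case: eqP => [-> //|_ /=]; exact: Hv.
Qed.

Definition listed (ds : seq (nat * nat * nat)) c x y : Prop := (c, x, y) \in ds.

Definition derivation (ds : seq (nat * nat * nat)) : Prop :=
  forall i c x y, i < size ds -> nth (0, 0, 0) ds i = (c, x, y) ->
    just (listed (take i ds)) c x y.

Lemma derivation_cat ds1 ds2 :
  derivation ds1 -> derivation ds2 -> derivation (ds1 ++ ds2).
Proof.
move=> D1 D2 i c x y; rewrite size_cat nth_cat take_cat.
case: (ltnP i (size ds1)) => [lt _ e|le lt e]; first exact: (D1 i c x y lt e).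
apply: just_mono (D2 _ c x y _ e); last lia.
by move=> c' x' y'; rewrite /listed mem_cat => ->; rewrite orbT.
Qed.

Lemma derivation_rcons ds c x y :
  derivation ds -> just (listed ds) c x y -> derivation (rcons ds (c, x, y)).
Proof.
move=> D J i c' x' y'; rewrite size_rcons ltnS nth_rcons -cats1 take_cat.
case: (ltngtP i (size ds)) => // [lt _ e|-> _ [<- <- <-]]; first exact: (D i c' x' y' lt e).
by rewrite subnn take0 cats0.
Qed.

Lemma computes_derivation c x y : computes c x y ->
  exists2 ds, derivation ds & listed ds c x y.
Proof.
have base c0 x0 y0 : just (listed [::]) c0 x0 y0 ->
    exists2 ds, derivation ds & listed ds c0 x0 y0.
  move=> J; exists (rcons [::] (c0, x0, y0)); first exact: derivation_rcons.
  by rewrite /listed mem_rcons mem_head.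
have step ds c0 x0 y0 : derivation ds -> just (listed ds) c0 x0 y0 ->
    exists2 ds, derivation ds & listed ds c0 x0 y0.
  move=> D J; exists (rcons ds (c0, x0, y0)); first exact: derivation_rcons.
  by rewrite /listed mem_rcons mem_head.
have inl ds1 ds2 c0 x0 y0 : listed ds1 c0 x0 y0 -> listed (ds1 ++ ds2) c0 x0 y0.
  by rewrite /listed mem_cat => ->.
have inr ds1 ds2 c0 x0 y0 : listed ds2 c0 x0 y0 -> listed (ds1 ++ ds2) c0 x0 y0.
  by rewrite /listed mem_cat => ->; rewrite orbT.
elim=> {c x y}.
- by move=> x; apply: base; left.
- by move=> x; apply: base; do 1 right; left.
- by move=> x; apply: base; do 2 right; left.
- by move=> x y; apply: base; do 3 right; left; split=> //; exists y.
- by move=> x y; apply: base; do 4 right; left; split=> //; exists x.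
- move=> f g x y z _ [d1 D1 L1] _ [d2 D2 L2].
  apply: (step (d1 ++ d2)); first exact: derivation_cat.
  do 5 right; left; exists f, g; split=> //; exists y, z; split=> //.
  by split; [apply: inl|apply: inr].
- move=> f g x y z _ [d1 D1 L1] _ [d2 D2 L2].
  apply: (step (d1 ++ d2)); first exact: derivation_cat.
  do 6 right; left; exists f, g; split=> //; exists y.
  by split; [apply: inl|apply: inr].
- move=> f g x y _ [d1 D1 L1]; apply: (step d1) => //.
  by do 7 right; left; exists f, g; split=> //; exists x.
- move=> f g x m z y _ [d1 D1 L1] _ [d2 D2 L2].
  apply: (step (d1 ++ d2)); first exact: derivation_cat.
  do 8 right; left; exists f, g; split=> //; exists x, z, m; split=> //.
  by split; [apply: inl|apply: inr].
- move=> f x y v _ [d1 D1 L1] _ IH.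
  suff [d2 D2 L2] : exists2 ds, derivation ds &
      forall j, j < y -> listed ds f (npair x j) (v j).+1.
    apply: (step (d1 ++ d2)); first exact: derivation_cat.
    do 9 right; exists f; split=> //; split; first exact: inl.
    by move=> j /L2 L; exists (v j); apply: inr.
  elim: y IH {L1} => [|y IHy] IH; first by exists [::].
  have [d D L] := IHy (fun j lt => IH j (ltnW lt)).
  have [d' D' L'] := IH y (ltnSn y).
  exists (d ++ d'); first exact: derivation_cat.
  move=> j; rewrite ltnS leq_eqVlt => /orP[/eqP->|/L]; first exact: inr.
  exact: inl.
Qed.

Lemma sat_MemW (s : nat -> N) e n : sat s (in_W n e) <->
  exists a b l : nat, (exists y, triple a b l e n y) /\
    forall i, i < l.+1 -> exists c x y,
      triple a b i c x y /\ just (earlier a b i) c x y.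
Proof.
have f1 : fresh 2 [:: Var 3; Var 4; Var 15;
    tpair (numeral e) (tpair (numeral n) (Var 8))].
  by rewrite /fresh /= !all_cat !tvars_numeral.
rewrite /in_W /MemW; cbn [sat].
setoid_rewrite (fun s => sat_Beta s f1).
setoid_rewrite sat_Justified.
setoid_rewrite sat_Beta; try by [].
setoid_rewrite sat_Less; try by [].
rewrite /tpair; cbn [eval].
setoid_rewrite eval_numeral.
by [].
Qed.

Theorem in_W_correct (s : nat -> N) e n : sat s (in_W n e) <-> W e n.
Proof.
rewrite sat_MemW; split=> [[a [b [l [[y e1] J]]]]|[y /computes_derivation[ds D L]]].
  suff H i : i < l.+1 -> forall c x y, triple a b i c x y -> computes c x y.
    by exists y; apply: H e1.
  elim/ltn_ind: i => i IH lti c x z e2.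
  have [c' [x' [z' [e3 /just_mono Ji]]]] := J i lti.
  have [-> /npair_inj[-> ->]] : c = c' /\ npair x z = npair x' z'.
    by apply: npair_inj; rewrite e2 e3.
  by apply/just_computes/Ji => f u v [j ltj]; apply: IH => //; apply: ltn_trans lti.
pose tr t := npair t.1.1 (npair t.1.2 t.2).
have [a [b ab]] := beta_exists (fun i => tr (nth (0, 0, 0) ds i)) (size ds).
have lt : index (e, n, y) ds < size ds by rewrite index_mem.
exists a, b, (index (e, n, y) ds); split.
  by exists y; rewrite /triple -ab // nth_index.
move=> i; rewrite ltnS => lei.
have lti : i < size ds by apply: leq_ltn_trans lei lt.
case e1: (nth (0, 0, 0) ds i) => [[c x] z].
exists c, x, z; split; first by rewrite /triple -ab // e1.
apply: just_mono (D i c x z lti e1) => c' x' z'.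
rewrite /listed => inn; exists (index (c', x', z') (take i ds)).
  by rewrite -{2}(size_takel (ltnW lti)) index_mem.
have lt' : index (c', x', z') (take i ds) < i.
  by rewrite -{2}(size_takel (ltnW lti)) index_mem.
rewrite /triple -ab; last exact: ltn_trans lti.
by rewrite -(nth_take _ lt') nth_index.
Qed.

End MemW_correct.

(* Main.v *)
Require Import Defs.
From mathcomp Require Import all_boot zify.
From Stdlib Require Import Classical.
Set Implicit Arguments.
Unset Strict Implicit.
Unset Printing Implicit Defensive.

(** The set is refuted by a liar sentence [sigma e] which is equivalent in Peano
arithmetic to the statement that its own code is not in [W_e].  The machine
knows that equivalence, knows [K sigma <-> code sigma \in W_e], and knows
[K sigma -> sigma].  Hence it knows [sigma]: were [sigma] false, its code would
be in [W_e], so [K sigma] would hold, and then [sigma].  By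
factivity, what the machine knows is true.  So [sigma] is true, its code is in
[W_e] because [K sigma] holds, and its code is not in [W_e] because [sigma]
holds.

All the work lies in the diagonal equivalence.  The logic is semantic: whatever
holds in all structures satisfying finitely many known formulas is known
([knows_consequence]), so a proof in arithmetic is an argument about arbitrary,
possibly nonstandard, structures satisfying a fixed finite list of axioms
([finite_PA]: the six basic axioms and three instances of induction).

The sentence is [Ex z (z = numeral n /\ A z)], with [n] the code of [A].  As the
pairing function is the value of a term, the code of this sentence is the value
of a term in [n] and [tcode (numeral n)]; no substitution function has to be
represented.  What remains is to define the function
[n |-> tcode (numeral n)] in arithmetic so that, for each standard [n], every
structure of the above kind agrees on its value.  Goedel's beta function codes
the sequence of values below [n], but uniqueness of remainders would require
much of arithmetic to be developed in nonstandard structures.  Instead, all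
quantifiers are bounded by one witness [w], and [w] is required to be least
([graph]).  Bounded formulas mean the same in a structure as in the natural
numbers as long as their parameters are standard ([sat_bounded]); a standard
witness exists, and every element is comparable with it ([less_std_total]), so
a least witness is standard and the value is the right one
([graph_represents]). *)

(** * Dependence of satisfaction on the assignment *)

Section Coincidence.
Variable M : structure.
Implicit Types (s r : nat -> M) (t : term) (phi : form).

Lemma eval_coincidence s r t : {in tvars t, s =1 r} -> eval s t = eval r t.
Proof.
elim: t => [x||t IH|t IHt u IHu|t IHt u IHu] //= E.
- by apply: E; rewrite inE.
- by rewrite IH.
- by rewrite IHt ?IHu // => x xt; apply: E; rewrite mem_cat xt ?orbT.
- by rewrite IHt ?IHu // => x xt; apply: E; rewrite mem_cat xt ?orbT.
Qed.

Lemma sat_coincidence s r phi : {in fvars phi, s =1 r} -> sat s phi <-> sat r phi.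
Proof.
have catP (a b : seq nat) s' r' : {in a ++ b, s' =1 r' :> (nat -> M)} ->
    {in a, s' =1 r'} /\ {in b, s' =1 r'}.
  by move=> E; split=> x xin; apply: E; rewrite mem_cat xin ?orbT.
have updP (a : seq nat) x s' r' d : {in [seq y <- a | y != x], s' =1 r' :> (nat -> M)} ->
    {in a, upd s' x d =1 upd r' x d}.
  move=> E y ya; rewrite /upd; case: eqP => // /eqP ne; apply: E.
  by rewrite mem_filter ne.
elim: phi s r => [t u||a IHa b IHb|a IHa b IHb|a IHa b IHb|x a IHa|x a IHa|a _] s r //=.
- by move=> /catP[Et Eu]; rewrite (eval_coincidence Et) (eval_coincidence Eu).
- by move=> /catP[/IHa Ea /IHb Eb]; tauto.
- by move=> /catP[/IHa Ea /IHb Eb]; tauto.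
- by move=> /catP[/IHa Ea /IHb Eb]; tauto.
- by move=> E; split=> H d; apply/(IHa _ _ (updP _ _ _ _ d E)).
- by move=> E; split=> -[d H]; exists d; apply/(IHa _ _ (updP _ _ _ _ d E)).
Qed.

Lemma upd_same s x d : upd s x d x = d.
Proof. by rewrite /upd eqxx. Qed.

Lemma eval_upd_notin s x d t : x \notin tvars t -> eval (upd s x d) t = eval s t.
Proof.
move=> xt; apply: eval_coincidence => y yt; rewrite /upd.
by case: eqP yt => // ->; rewrite (negbTE xt).
Qed.

Lemma eval_upd_fresh s x d t n : x < n -> all (leq n) (tvars t) ->
  eval (upd s x d) t = eval s t.
Proof.
by move=> ltxn /allP fr; apply: eval_upd_notin; apply/negP => /fr; lia.
Qed.

(** The known equivalences mention the numeral of a code, the diagonal sentence a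
term computing this code; this lemma passes from one to the other. *)
Lemma MemW_congr s e t u : all (leq 16) (tvars t) -> all (leq 16) (tvars u) ->
  eval s t = eval s u ->
  sat s (MemW (numeral e) t) <-> sat s (MemW (numeral e) u).
Proof.
wlog suff: t u / all (leq 16) (tvars t) -> all (leq 16) (tvars u) ->
    eval s t = eval s u -> sat s (MemW (numeral e) t) -> sat s (MemW (numeral e) u).
  by move=> H ft fu E; split; apply: H.
move=> ft fu E [a [b [l [[y [q [Eq [d Lt]]]] R]]]].
exists a, b, l; split; last exact: R.
exists y, q; split; last exists d; move: Eq Lt; rewrite /=.
  by rewrite !(eval_upd_fresh _ _ _ ft) // !(eval_upd_fresh _ _ _ fu) // E.
by rewrite !(eval_upd_fresh _ _ _ ft) // !(eval_upd_fresh _ _ _ fu) // E.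
Qed.

End Coincidence.

(** * A finite fragment of Peano arithmetic *)

(** Three consequences of induction are enough here; they are what
[less_std_total] needs beyond the basic axioms. *)
Record arithmetic (M : structure) : Prop := Arithmetic {
  succ_neq0 : forall x : M, succI x <> zeroI M;
  succ_inj : forall x y : M, succI x = succI y -> x = y;
  add0 : forall x : M, addI x (zeroI M) = x;
  addS : forall x y : M, addI x (succI y) = succI (addI x y);
  mul0 : forall x : M, mulI x (zeroI M) = zeroI M;
  mulS : forall x y : M, mulI x (succI y) = addI (mulI x y) x;
  zero_or_succ : forall x : M, x = zeroI M \/ exists y, x = succI y;
  add0l : forall x : M, addI (zeroI M) x = x;
  addSl : forall x y : M, addI (succI x) y = succI (addI x y)
}.

Definition induction (phi : form) : form :=
  univ_closure (Imp (subst 0 Zero phi)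
    (Imp (All 0 (Imp phi (subst 0 (Succ (Var 0)) phi))) (All 0 phi))).

(** A finite list, because knowledge is closed under consequence of finitely many
formulas only. *)
Definition finite_PA : seq form := [::
  All 0 (Neg (Equ (Succ (Var 0)) Zero));
  All 0 (All 1 (Imp (Equ (Succ (Var 0)) (Succ (Var 1))) (Equ (Var 0) (Var 1))));
  All 0 (Equ (Add (Var 0) Zero) (Var 0));
  All 0 (All 1 (Equ (Add (Var 0) (Succ (Var 1))) (Succ (Add (Var 0) (Var 1)))));
  All 0 (Equ (Mul (Var 0) Zero) Zero);
  All 0 (All 1 (Equ (Mul (Var 0) (Succ (Var 1))) (Add (Mul (Var 0) (Var 1)) (Var 0))));
  induction (Or (Equ (Var 0) Zero) (Ex 1 (Equ (Var 0) (Succ (Var 1)))));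
  induction (Equ (Add Zero (Var 0)) (Var 0));
  induction (Equ (Add (Succ (Var 1)) (Var 0)) (Succ (Add (Var 1) (Var 0))))].

Lemma finite_PA_PA : List.Forall PA finite_PA.
Proof. by do 9 (constructor; first by constructor). Qed.

Lemma finite_PA_arithmetic (M : structure) (s : nat -> M) :
  List.Forall (sat s) finite_PA -> arithmetic M.
Proof.
do 9 move/List.Forall_cons_iff=> [] /[swap].
move=> _; rewrite /induction /univ_closure /= /upd /=.
move=> a0Sl a0l zs mS m0 aS a0 Si S0.
split=> //.
- by apply: zs => [|d _]; [left | right; exists d].
- by apply: a0l => [|d]; rewrite ?a0 // aS => ->.
- move=> x y; apply: (a0Sl x); first by rewrite !a0.
  by move=> d; rewrite !aS => ->.
Qed.

(** * The standard part of a structure *)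

Section Standard_part.
Variable M : structure.
Hypothesis M_arith : arithmetic M.

Fixpoint std (n : nat) : M := if n is m.+1 then succI (std m) else zeroI M.

Definition less (x y : M) : Prop := exists d, addI x (succI d) = y.

Lemma eval_numeral_std s n : eval s (numeral n) = std n.
Proof. by elim: n => //= n ->. Qed.

Lemma std_inj : injective std.
Proof.
elim=> [|m IH] [|n] //= E; first by case: (succ_neq0 M_arith (esym E)).
  by case: (succ_neq0 M_arith E).
by rewrite (IH n) //; apply: (succ_inj M_arith).
Qed.

Lemma std_add m n : std (m + n) = addI (std m) (std n).
Proof.
elim: n => [|n IH]; first by rewrite addn0 (add0 M_arith).
by rewrite addnS /= IH (addS M_arith).
Qed.

Lemma std_mul m n : std (m * n) = mulI (std m) (std n).
Proof.
elim: n => [|n IH]; first by rewrite muln0 (mul0 M_arith).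
by rewrite mulnSr std_add /= IH (mulS M_arith).
Qed.

(** No nonstandard element lies below a standard one: peel successors off both
sides of [x + S d = n]. *)
Lemma less_std x n : less x (std n) <-> exists2 k, k < n & x = std k.
Proof.
split=> [|[k ltkn ->]]; last first.
  exists (std (n - k.+1)); rewrite -[succI _]/(std (n - k.+1).+1) -std_add.
  by congr std; lia.
elim: n x => [|n IH] x [d] /=; rewrite (addS M_arith).
  by move/(succ_neq0 M_arith).
move/(succ_inj M_arith).
case: (zero_or_succ M_arith d) => [->|[d' ->]].
  by rewrite (add0 M_arith) => ->; exists n.
by move=> E; have [|k ltkn ->] := IH x; [exists d' | exists k => //; lia].
Qed.

(** The induction is on the standard number [n], outside the structure, so it
asks for no induction axiom about the order. *)
Lemma less_std_total x n : [\/ less x (std n), x = std n | less (std n) x].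
Proof.
elim: n => [|n [[d E]|E|[d E]]] /=.
- case: (zero_or_succ M_arith x) => [->|[y ->]]; first by constructor 2.
  by constructor 3; exists y; rewrite (add0l M_arith).
- by constructor 1; exists (succI d); rewrite (addS M_arith) E.
- by constructor 1; exists (zeroI M); rewrite (addS M_arith) (add0 M_arith) E.
- case: (zero_or_succ M_arith d) E => [->|[d' ->]] E.
    by constructor 2; rewrite -E (addS M_arith) (add0 M_arith).
  by constructor 3; exists d'; rewrite (addSl M_arith) -(addS M_arith).
Qed.

Lemma sat_Less_less s t u : fresh 1 [:: t; u] ->
  sat s (Less t u) <-> less (eval s t) (eval s u).
Proof.
by move=> /and3P[ft fu _]; split=> -[d E]; exists d; move: E;
  rewrite /= !(eval_upd_fresh _ _ _ ft, eval_upd_fresh _ _ _ fu).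
Qed.

Lemma sat_Less_Var s x y :
  sat s (Less (Var x.+1) (Var y.+1)) <-> less (s x.+1) (s y.+1).
Proof. by rewrite sat_Less_less. Qed.

End Standard_part.

(** * Absoluteness of bounded formulas *)

Definition ExLt (x : nat) (t : term) (phi : form) := Ex x (And (Less (Var x) t) phi).
Definition AllLt (x : nat) (t : term) (phi : form) := All x (Imp (Less (Var x) t) phi).

(** [Less] counts as atomic although it is an existential formula: on standard
elements its meaning is fixed by [less_std]. *)
Inductive bounded : form -> Prop :=
| bounded_Equ t u : bounded (Equ t u)
| bounded_Less t u : fresh 1 [:: t; u] -> bounded (Less t u)
| bounded_Bot : bounded Bot
| bounded_Imp phi psi : bounded phi -> bounded psi -> bounded (Imp phi psi)
| bounded_And phi psi : bounded phi -> bounded psi -> bounded (And phi psi)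
| bounded_ExLt x t phi : fresh 1 [:: Var x; t] -> x \notin tvars t ->
    bounded phi -> bounded (ExLt x t phi)
| bounded_AllLt x t phi : fresh 1 [:: Var x; t] -> x \notin tvars t ->
    bounded phi -> bounded (AllLt x t phi).

Notation N := (standard (fun=> False)).

Lemma eval_std (M : structure) (M_arith : arithmetic M) (s : nat -> N) t :
  eval (fun x => std M (s x)) t = std M (eval s t).
Proof.
elim: t => [x||t IH|t IHt u IHu|t IHt u IHu] //=; first by rewrite IH.
  by rewrite IHt IHu std_add.
by rewrite IHt IHu std_mul.
Qed.

(** A quantifier bounded by a standard element ranges over standard elements
only, by [less_std]. *)
Lemma sat_bounded (M : structure) (M_arith : arithmetic M) (s : nat -> N) phi :
  bounded phi -> sat (fun x => std M (s x)) phi <-> sat s phi.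
Proof.
move=> B; elim: B s => {phi}
  [t u|t u fr||a b _ IHa _ IHb|a b _ IHa _ IHb|x t a fr xt _ IH|x t a fr xt _ IH] s.
- by rewrite /= !eval_std //; split=> [/(std_inj M_arith)|->].
- rewrite (sat_Less_less _ fr) (sat_Less _ fr) !eval_std // less_std //.
  by split=> [[k lek /(std_inj M_arith) ->] | ltu] //; exists (eval s t).
- by [].
- by rewrite /=; rewrite IHa IHb.
- by rewrite /=; rewrite IHa IHb.
- have step k : sat (upd (fun y => std M (s y)) x (std M k)) a <-> sat (upd s x k) a.
    by rewrite -IH; apply: sat_coincidence => y _; rewrite /upd; case: eqP.
  split=> [[d [/(sat_Less_less _ fr)]]|[k [/(sat_Less _ fr)]]].
    rewrite /= upd_same eval_upd_notin // eval_std // less_std // => -[k ltk ->] /step Ha.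
    exists k; split=> //; apply/(sat_Less _ fr).
    by rewrite /= upd_same (eval_upd_notin _ _ xt).
  rewrite /= upd_same (eval_upd_notin _ _ xt) => ltk /step Ha.
  exists (std M k); split=> //; apply/(sat_Less_less _ fr).
  by rewrite /= upd_same eval_upd_notin // eval_std // less_std //; exists k.
- have step k : sat (upd (fun y => std M (s y)) x (std M k)) a <-> sat (upd s x k) a.
    by rewrite -IH; apply: sat_coincidence => y _; rewrite /upd; case: eqP.
  split=> H.
    move=> k /(sat_Less _ fr).
    rewrite /= upd_same (eval_upd_notin _ _ xt) => ltk.
    apply/step/H/(sat_Less_less _ fr).
    by rewrite /= upd_same eval_upd_notin // eval_std // less_std //; exists k.
  move=> d /(sat_Less_less _ fr).
  rewrite /= upd_same eval_upd_notin // eval_std // less_std // => -[k ltk ->].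
  apply/step/H/(sat_Less _ fr).
  by rewrite /= upd_same (eval_upd_notin _ _ xt).
Qed.

(** Variables that do not occur free may have nonstandard values. *)
Lemma sat_bounded_on (M : structure) (M_arith : arithmetic M) (r : nat -> M)
    (s : nat -> N) phi :
  bounded phi -> {in fvars phi, forall x, r x = std M (s x)} ->
  sat r phi <-> sat s phi.
Proof.
move=> B E; rewrite -(sat_bounded M_arith s B); exact: sat_coincidence.
Qed.

(** * Representing functions by least witnesses *)

(** Variable 20 is the argument, 19 the value; the parameter of [theta] is the
variable holding the witness, 17 for the least witness and 18 for a smaller
one.  Only the witness is asked to be least: below a standard witness the value
is standard as well. *)
Definition graph (theta : nat -> form) : form :=
  Ex 17 (And (And (Less (Var 19) (Var 17)) (theta 17))
             (AllLt 18 (Var 17) (Neg (ExLt 19 (Var 18) (theta 18))))).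

Lemma least_witness (Q : nat -> Prop) n : Q n ->
  exists2 m, Q m & forall k, k < m -> ~ Q k.
Proof.
elim/ltn_ind: n => n IH Qn.
case: (classic (exists2 k, k < n & Q k)) => [[k lt Qk]|H]; first exact: IH lt Qk.
by exists n => // k lt Qk; case: H; exists k.
Qed.

(** For the standard argument [n] some standard [w0] is a witness, and a least
witness [d] of the structure is comparable with it.  If [d <= w0] then [d] is
standard, and [R] decides the value; if [w0 < d] then [d] is not least.
Conversely the least witness among the natural numbers is least in the
structure. *)
Lemma graph_represents (theta : nat -> form) (R : nat -> nat -> nat -> Prop)
    (f : nat -> nat) :
  {in [:: 17; 18], forall w, bounded (theta w)} ->
  {in [:: 17; 18], forall w, {subset fvars (theta w) <= [:: 19; 20; w]}} ->
  {in [:: 17; 18], forall w (s : nat -> N),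
    sat s (theta w) <-> R (s 20) (s 19) (s w)} ->
  (forall n y w, R n y w -> y = f n) ->
  (forall n, exists2 w, f n < w & R n (f n) w) ->
  forall (M : structure) (s : nat -> M) n, arithmetic M -> s 20 = std M n ->
  sat s (graph theta) <-> s 19 = std M (f n).
Proof.
move=> bd fv thR Rf Rex M s n MA s20.
have tr w (r : nat -> M) y k : w \in [:: 17; 18] -> r 20 = std M n ->
    r 19 = std M y -> r w = std M k -> sat r (theta w) <-> R n y k.
  move=> wP r20 r19 rw.
  pose s' x : N := if x == 20 then n else if x == 19 then y else k.
  have ww : (w == 20) = false /\ (w == 19) = false.
    by move: wP; rewrite !inE => /orP[] /eqP->.
  have -> : R n y k <-> sat s' (theta w).
    by rewrite thR // /s' ww.1 ww.2.
  apply: sat_bounded_on => //; first exact: bd.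
  move=> x /(fv _ wP); rewrite !inE => /or3P[] /eqP->; rewrite /s' //=.
  by rewrite ww.1 ww.2.
split.
  case=> d [[/sat_Less_Var lty thd] /= least].
  have [w0 lt0 Rw0] := Rex n.
  have {lty} : less (s 19) d by apply: lty.
  suff H k : d = std M k -> less (s 19) d -> s 19 = std M (f n).
    case: (less_std_total MA d w0) => [/(less_std MA)[k _]|//|ltd]; try exact: H.
    move=> _; case: (least (std M w0)); first by apply/sat_Less_Var.
    exists (std M (f n)); split.
      by apply/sat_Less_Var/(proj2 (less_std MA _ w0)); exists (f n).
    by apply: (proj2 (tr 18 _ (f n) w0 _ _ _ _)).
  move=> E; rewrite {1}E => /(less_std MA)[y _ s19]; rewrite s19; congr std.
  by apply: (Rf n y k); apply: (proj1 (tr 17 _ y k _ _ _ _) thd).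
move=> s19.
have [w0 lt0 Rw0] := Rex n.
have [|w [y0 lty0 Ry0] least] := @least_witness (fun w => exists2 y, y < w & R n y w) w0.
  by exists (f n).
have E0 := Rf _ _ _ Ry0; subst y0.
exists (std M w); split; first split.
- by apply/sat_Less_Var/(proj2 (less_std MA _ w)); exists (f n).
- by apply: (proj2 (tr 17 _ (f n) w _ _ _ _)).
move=> d /sat_Less_Var ltd [z [/sat_Less_Var ltz thd]].
have /(less_std MA)[k ltk E] : less d (std M w) by apply: ltd.
have /(less_std MA)[y lty s19'] : less z (std M k) by rewrite -E; apply: ltz.
apply: (least k ltk); exists y => //.
by apply: (proj1 (tr 18 _ y k _ _ _ _) thd).
Qed.

(** * The code of the numeral of n *)

(** Variables 21 and 22 hold the two parameters of the beta function.  Unlike in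
[Beta] the quotient is bounded by the witness, which makes the formula
bounded. *)
Definition remainder (i r : term) (w : nat) : form :=
  let m := Succ (Mul (Succ i) (Var 22)) in
  ExLt 23 (Var w) (And (Equ (Var 21) (Add (Mul (Var 23) m) r)) (Less r m)).

(** The beta function lists [tcode (numeral 0), ..., tcode (numeral n)]; 2 is the
tag of [Succ] in [tcode], which gives the recursion step. *)
Definition numeral_code (w : nat) : form :=
  ExLt 21 (Var w) (ExLt 22 (Var w)
    (And (And (remainder Zero (numeral (tcode Zero)) w)
              (remainder (Var 20) (Var 19) w))
         (AllLt 24 (Var 20) (ExLt 25 (Var w)
           (And (remainder (Var 24) (Var 25) w)
                (remainder (Succ (Var 24)) (tpair (numeral 2) (Var 25)) w)))))).

Definition remainder_rel (a b i r w : nat) : Prop :=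
  exists q, q < w /\ a = q * (i.+1 * b).+1 + r /\ r < (i.+1 * b).+1.

(** The connectives follow those of [numeral_code] literally, so that the two agree
as soon as [Less] is interpreted. *)
Definition numeral_code_rel (n y w : nat) : Prop :=
  exists a, a < w /\ exists b, b < w /\
    (remainder_rel a b 0 (tcode Zero) w /\ remainder_rel a b n y w) /\
    forall i, i < n -> exists v, v < w /\
      remainder_rel a b i v w /\ remainder_rel a b i.+1 (npair 2 v) w.

Lemma numeral_code_bounded w : w \in [:: 17; 18] -> bounded (numeral_code w).
Proof.
by rewrite !inE => /orP[] /eqP->; repeat (constructor=> //).
Qed.

Lemma numeral_code_fvars w : w \in [:: 17; 18] ->
  {subset fvars (numeral_code w) <= [:: 19; 20; w]}.
Proof.
by rewrite !inE => /orP[] /eqP->; apply/allP; vm_compute.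
Qed.

Lemma sat_numeral_code w (s : nat -> N) : w \in [:: 17; 18] ->
  sat s (numeral_code w) <-> numeral_code_rel (s 20) (s 19) (s w).
Proof.
rewrite !inE => /orP[] /eqP->; rewrite /numeral_code /remainder /ExLt /AllLt /tpair;
  cbn [sat]; do ! (setoid_rewrite sat_Less; try by []); by [].
Qed.

Lemma remainder_relE a b i r w : remainder_rel a b i r w -> r = a %% (i.+1 * b).+1.
Proof. by case=> q [_ [-> lt]]; rewrite modnMDl modn_small. Qed.

Lemma remainder_rel_modn a b i w : a < w ->
  remainder_rel a b i (a %% (i.+1 * b).+1) w.
Proof.
move=> lt; exists (a %/ (i.+1 * b).+1); rewrite -divn_eq ltn_pmod //.
by split=> //; apply: leq_ltn_trans (leq_div _ _) lt.
Qed.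

Lemma numeral_code_rel_functional n y w :
  numeral_code_rel n y w -> y = tcode (numeral n).
Proof.
case=> a [_ [b [_ [[/remainder_relE r0 /remainder_relE ->] step]]]].
suff H k : k <= n -> a %% (k.+1 * b).+1 = tcode (numeral k) by exact: H.
elim: k => [|k IH] lek; first by rewrite -r0.
have [v [_ [/remainder_relE ev /remainder_relE <-]]] := step k lek.
by rewrite ev IH // ltnW.
Qed.

Lemma numeral_code_rel_total n :
  exists2 w, tcode (numeral n) < w & numeral_code_rel n (tcode (numeral n)) w.
Proof.
have [a [b ab]] := beta_exists (fun k => tcode (numeral k)) n.+1.
have lea k : k < n.+1 -> tcode (numeral k) <= a by move/ab=> ->; exact: leq_mod.
(* Quotients and remainders of [a] are at most [a], so this bounds everything. *)
exists (a + b).+1; first by have := lea n; lia.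
exists a; split; first lia; exists b; split; first lia.
have R k : k < n.+1 -> remainder_rel a b k (tcode (numeral k)) (a + b).+1.
  by move=> lt; rewrite ab //; apply: remainder_rel_modn; lia.
split; first by split; apply: (R _).
move=> i lt; exists (tcode (numeral i)); split; first by have := lea i; lia.
by split; apply: (R _); rewrite ?ltnS // ltnW.
Qed.

Lemma sat_graph_numeral_code (M : structure) (s : nat -> M) n :
  arithmetic M -> s 20 = std M n ->
  sat s (graph numeral_code) <-> s 19 = std M (tcode (numeral n)).
Proof.
apply: (@graph_represents numeral_code numeral_code_rel (tcode \o numeral)).
- exact: numeral_code_bounded.
- exact: numeral_code_fvars.
- by move=> w wP s'; apply: sat_numeral_code.
- exact: numeral_code_rel_functional.
- exact: numeral_code_rel_total.
Qed.

(** * The diagonal sentence *)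

Lemma eval_tpair_std (M : structure) (MA : arithmetic M) (s : nat -> M) x y t u :
  eval s t = std M x -> eval s u = std M y -> eval s (tpair t u) = std M (npair x y).
Proof. by move=> Et Eu; rewrite /= Et Eu /npair !(std_add MA, std_mul MA). Qed.

(** The code of [Ex x (And (Equ (Var x) t) A)], as a term in the code [y] of [t]
and the code [z] of [A]. *)
Definition self_code (x : nat) (y z : term) : term :=
  tpair (numeral 6) (tpair (numeral x) (tpair (numeral 3)
    (tpair (tpair (numeral 0) (tpair (numeral (tcode (Var x))) y)) z))).

Lemma eval_self_code (M : structure) (s : nat -> M) x t a y z :
  arithmetic M -> eval s y = std M (tcode t) -> eval s z = std M (code a) ->
  eval s (self_code x y z) = std M (code (Ex x (And (Equ (Var x) t) a))).
Proof.
move=> MA Ey Ez; pose E := eval_numeral_std s.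
pose P := eval_tpair_std MA.
exact: (P _ _ _ _ _ (E 6) (P _ _ _ _ _ (E x) (P _ _ _ _ _ (E 3)
  (P _ _ _ _ _ (P _ _ _ _ _ (E 0) (P _ _ _ _ _ (E (tcode (Var x))) Ey)) Ez)))).
Qed.

Definition diagonal_body (e : nat) : form :=
  Ex 19 (And (graph numeral_code)
             (Neg (MemW (numeral e) (self_code 20 (Var 19) (Var 20))))).

Definition sigma (e : nat) : form :=
  Ex 20 (And (Equ (Var 20) (numeral (code (diagonal_body e)))) (diagonal_body e)).

Lemma fvars_in_W n e : fvars (in_W n e) = [::].
Proof. by rewrite /in_W /MemW /Beta /tpair /= !tvars_numeral. Qed.

(** In the sentence, variable 20 takes the value [n], the code of
[diagonal_body e], and variable 19 then takes the value [tcode (numeral n)], so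
[self_code] evaluates to the code of the sentence itself. *)
Lemma sigma_fixpoint (M : structure) (s : nat -> M) e : arithmetic M ->
  sat s (sigma e) <-> ~ sat s (in_W (code (sigma e)) e).
Proof.
move=> MA; rewrite /sigma.
(* [n] is made opaque, as conversion would otherwise unfold this huge number. *)
have [n n_code] : exists n, n = code (diagonal_body e) by eexists.
rewrite -n_code; set phi := Ex 20 _.
have key (z y : M) : z = std M n -> y = std M (tcode (numeral n)) ->
    sat (upd (upd s 20 z) 19 y) (MemW (numeral e) (self_code 20 (Var 19) (Var 20)))
    <-> sat s (in_W (code phi) e).
  move=> Ez Ey; rewrite (@MemW_congr _ _ _ _ (numeral (code phi))).
  - by apply: sat_coincidence => x; rewrite fvars_in_W.
  - by [].
  - by rewrite tvars_numeral.
  rewrite eval_numeral_std.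
  apply: (@eval_self_code _ _ _ (numeral n) (diagonal_body e)) => //.
  by rewrite -n_code; exact: Ez.
split.
  case=> z [Ez [y [gr nW]]] W; apply: nW.
  have {}Ez : z = std M n := etrans Ez (eval_numeral_std _ n).
  apply: (proj2 (key z y Ez _) W).
  exact: (proj1 (sat_graph_numeral_code MA _) gr).
move=> nW; exists (std M n); split; first exact: esym (eval_numeral_std _ n).
exists (std M (tcode (numeral n))); split; first exact/(sat_graph_numeral_code MA).
by move=> W; apply: nW; apply: (proj1 (key _ _ _ _) W).
Qed.

(** * The contradiction *)

(** The deduction theorem in semantic form: if [phi] holds wherever [Gamma]
holds, then the iterated implication from [Gamma] to [phi] is valid. *)
Lemma knows_consequence (T : form -> Prop) (Gamma : seq form) (phi : form) :
  (forall psi, valid psi -> T psi) ->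
  (forall psi chi, T (Imp psi chi) -> T psi -> T chi) ->
  List.Forall T Gamma ->
  (forall (M : structure) (s : nat -> M), List.Forall (sat s) Gamma -> sat s phi) ->
  T phi.
Proof.
move=> Tvalid Tmp; elim: Gamma phi => [|a Gamma IH] phi.
  by move=> _ H; apply: Tvalid => M s; apply: H; constructor.
move=> /List.Forall_cons_iff[Ta TG] H; apply: Tmp Ta; apply: IH => // M s sG sa.
by apply: H; constructor.
Qed.

Theorem proposition4 (e : nat) : inconsistent (Sigma e).
Proof.
move=> M MS s; set W := in_W (code (sigma e)) e.
have axiom_true psi : knowing_machine psi -> sat s psi.
  by move=> ax; apply: MS; constructor 1.
have valid_known psi (v : valid psi) : knowI M psi :=
  axiom_true _ (km_basic (know_tautology v)).
have known_mp psi chi : knowI M (Imp psi chi) -> knowI M psi -> knowI M chi :=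
  axiom_true _ (km_basic (know_mp psi chi)).
have PA_known psi (ax : PA psi) : knowI M psi :=
  axiom_true _ (km_basic (know_arithmetic ax)).
have known_true psi : knowI M psi -> sat s psi := axiom_true _ (km_factivity psi).
have known_factivity : knowI M (Imp (K (sigma e)) (sigma e)).
  by apply: (MS (K (Imp (K _) _)) _ s); constructor 2; exists (sigma e).
have known_code : knowI M (Iff (K (sigma e)) W).
  by apply: (MS (K (Iff (K _) W)) _ s); constructor 3; exists (sigma e).
have PA_all : List.Forall (knowI M) finite_PA.
  by apply: List.Forall_impl finite_PA_PA.
have known_sigma : knowI M (sigma e).
  apply: (@knows_consequence _
    [:: Imp (K (sigma e)) (sigma e), Iff (K (sigma e)) W & finite_PA]) => //.
    by do 2 constructor=> //.
  move=> M' r /List.Forall_cons_iff[fact /List.Forall_cons_iff[[_ KW] ar]].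
  have diag := sigma_fixpoint r e (finite_PA_arithmetic ar).
  apply: NNPP => nsig; case: (nsig); apply/diag => /KW /fact; exact: nsig.
have known_diagonal : knowI M (Imp (sigma e) (Neg W)).
  apply: (@knows_consequence _ finite_PA) => // M' r ar.
  exact: (proj1 (sigma_fixpoint r e (finite_PA_arithmetic ar))).
have [KW _] := known_true _ known_code.
exact: known_true _ known_diagonal (known_true _ known_sigma) (KW known_sigma).
Qed.
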